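(* Let $\mathfrak{m}$ be a finitely generated Leibniz algebra over a field $\mathbb{K}$. Then the following are equivalent: (i) $[\mathfrak{m},\mathfrak{m}]$ is finitely generated; (ii) there exists a central extension $0\to\mathfrak{r}\to\mathfrak{l}\to\mathfrak{m}\to 0$ of Leibniz algebras such that $[\mathfrak{l},\mathfrak{l}]$ is finitely generated; (iii) for every central extension $0\to\mathfrak{r}\to\mathfrak{l}\to\mathfrak{m}\to 0$ of Leibniz algebras, $[\mathfrak{l},\mathfrak{l}]$ is finitely generated.
   Context: $\mathbb{K}$ is a field. Leibniz algebras are right Leibniz algebras over $\mathbb{K}$: vector spaces with a bilinear bracket satisfying $[x,[y,z]]=[[x,y],z]-[[x,z],y]$. For a Leibniz algebra $\mathfrak{l}$, $[\mathfrak{l},\mathfrak{l}]$ is the Leibniz commutator, i.e. the (two-sided) ideal spanned by all brackets $[x,y]$, $x,y\in\mathfrak{l}$. ''Finitely generated'' means finitely generated as a Leibniz algebra. A central extension is a short exact sequence $0\to\mathfrak{r}\to\mathfrak{l}\to\mathfrak{m}\to 0$ of Leibniz algebras in which $[r,l]=0=[l,r]$ for all $r\in\mathfrak{r}$, $l\in\mathfrak{l}$. *)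

(* Defs.v *)
From HB Require Import structures.
From mathcomp Require Import all_boot all_order all_algebra.
From mathcomp Require Import boolp classical_sets functions cardinality.
Set Implicit Arguments.
Unset Strict Implicit.
Unset Printing Implicit Defensive.
Import GRing.Theory.
Local Open Scope ring_scope.
Local Open Scope classical_set_scope.

(* Right Leibniz algebras: each [bracket^~ z] is a derivation. No finiteness
   of the dimension is assumed. *)
HB.mixin Record Lmodule_isLeibniz (K : fieldType) L of GRing.Lmodule K L := {
  bracket : L -> L -> L;
  bracket_linearl : forall y : L, linear (bracket^~ y);
  bracket_linearr : forall x : L, linear (bracket x);
  leibniz_identity : forall x y z : L,
    bracket x (bracket y z) =
      bracket (bracket x y) z - bracket (bracket x z) y
}.

#[short(type="leibnizType")]
HB.structure Definition Leibniz (K : fieldType) :=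
  { L of GRing.Lmodule K L & Lmodule_isLeibniz K L }.

Section Subobjects.
Variables (K : fieldType) (L : leibnizType K).
Implicit Types (A X : set L).

Definition is_subspace A :=
  A 0 /\ forall (a : K) (x y : L), A x -> A y -> A (a *: x + y).

Definition is_subalgebra A :=
  is_subspace A /\ forall x y : L, A x -> A y -> A (bracket x y).

Definition is_ideal A :=
  is_subspace A /\ forall x y : L, A x -> A (bracket x y) /\ A (bracket y x).

Definition subalgebra_gen X : set L := smallest is_subalgebra X.

(* For a subalgebra A; the whole algebra is the case A = [set: L]. Any
   generating set X lies in A, as X `<=` subalgebra_gen X. *)
Definition finitely_generated A :=
  exists2 X : set L, finite_set X & subalgebra_gen X = A.

Definition span X : set L := smallest is_subspace X.

Definition commutator : set L :=
  span [set z | exists x y : L, z = bracket x y].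

Lemma commutator_ideal : is_ideal commutator.
Proof.
split; first split.
- by move=> A [[A0 _] _].
- move=> a x y Cx Cy A /= AP; case: (AP) => -[_ Alin] _.
  by apply: Alin; [exact: Cx | exact: Cy].
- by move=> x y _; split=> A [_ sA]; apply: sA; [exists x, y | exists y, x].
Qed.

Lemma commutator_subalgebra : is_subalgebra commutator.
Proof.
have [subC idC] := commutator_ideal.
by split=> // x y Cx _; case: (idC x y Cx).
Qed.

End Subobjects.

Arguments commutator {K} L.

Definition leibniz_morphism (K : fieldType) (L M : leibnizType K)
    (f : L -> M) :=
  linear f /\ {morph f : x y / bracket x y}.

(* 0 -> r --f--> l --g--> m -> 0 *)
Definition central_extension (K : fieldType) (r l m : leibnizType K)
    (f : r -> l) (g : l -> m) :=
  [/\ leibniz_morphism f, leibniz_morphism g,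
      [/\ injective f, range f = g @^-1` [set 0] & range g = [set: m]]
    & forall (x : r) (y : l), bracket (f x) y = 0 /\ bracket y (f x) = 0].

(* Main.v *)
Require Import Defs.
From HB Require Import structures.
From mathcomp Require Import all_boot all_order all_algebra.
From mathcomp Require Import boolp classical_sets functions cardinality.
Set Implicit Arguments.
Unset Strict Implicit.
Unset Printing Implicit Defensive.
Import GRing.Theory.
Local Open Scope ring_scope.
Local Open Scope classical_set_scope.

(** Finite generation of [[l, l]] is insensitive to the centre because a
    bracket only sees its arguments modulo the centre. It passes from [l] to
    [m] since [[l, l]] maps onto [[m, m]] ([image_commutator],
    [finitely_generated_image]); the extension of [m] by the zero algebra
    links (i) to (ii). The real content is the ascent from [[m, m]] to
    [[l, l]], which is [finitely_generated_commutator_lift].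

    For the ascent, let [Y] be a finite set of lifts to [l] of generators of
    [m], and [Z] a finite set of elements of [[l, l]] lifting generators of
    [[m, m]]. The subalgebra [<Z>] covers [[m, m]], so [[l, l]] lies in
    [<Z> + ker g]; the kernel could be infinite dimensional, so [Z] alone need
    not generate [[l, l]]. Let [B] be the subalgebra generated by the finite
    set of all [z], [[z, y]] and [[y, y']], with [z] in [Z] and [y, y'] in [Y].
    As [[-, y]] is a derivation, it maps [<Z>] into [B]; it also maps [Y] into
    [B] and kills [ker g]. But [l] is spanned by [Y], [<Z>] and [ker g], hence
    [[l, y]] lies in [B] for all [y] in [Y]. Finally the [v] with [[l, v]]
    contained in [B] form a subalgebra, by the Leibniz identity; it contains
    [Y] and [ker g], so it is [l], and [[l, l] = B]. *)

(** * Subspaces and generated subalgebras *)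

Section Generated.
Variables (K : fieldType) (L : leibnizType K).
Implicit Types (A X Z B : set L) (y : L).

Lemma bracketDl (a : K) (x y z : L) :
  bracket (a *: x + y) z = a *: bracket x z + bracket y z.
Proof. exact: bracket_linearl. Qed.

Lemma bracketDr (a : K) (x y z : L) :
  bracket z (a *: x + y) = a *: bracket z x + bracket z y.
Proof. exact: bracket_linearr. Qed.

Lemma bracket0l (z : L) : bracket 0 z = 0.
Proof. by have := bracketDl (-1) 0 0 z; rewrite scaler0 addr0 scaleN1r addNr. Qed.

Lemma bracket0r (z : L) : bracket z 0 = 0.
Proof. by have := bracketDr (-1) 0 0 z; rewrite scaler0 addr0 scaleN1r addNr. Qed.

Lemma subspaceD A x y : is_subspace A -> A x -> A y -> A (x + y).
Proof. by move=> [_ lin] Ax Ay; have := lin 1 x y Ax Ay; rewrite scale1r. Qed.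

Lemma subspaceB A x y : is_subspace A -> A x -> A y -> A (x - y).
Proof.
by move=> [_ lin] Ax Ay; have := lin (-1) y x Ay Ax; rewrite scaleN1r addrC.
Qed.

Lemma subalgebra_gen_subalgebra X : is_subalgebra (subalgebra_gen X).
Proof.
split; first split.
- by move=> A [[[A0 _] _] _].
- move=> a x y Gx Gy A /= AP; case: (AP) => -[[_ lin] _] _.
  by apply: lin; [exact: Gx | exact: Gy].
- move=> x y Gx Gy A /= AP; case: (AP) => -[_ mul] _.
  by apply: mul; [exact: Gx | exact: Gy].
Qed.

Lemma span_subspace X : is_subspace (Defs.span X).
Proof.
split; first by move=> A [[A0 _] _].
move=> a x y Gx Gy A /= AP; case: (AP) => -[_ lin] _.
by apply: lin; [exact: Gx | exact: Gy].
Qed.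

Lemma commutator_bracket (x y : L) : commutator L (bracket x y).
Proof. by apply: sub_gen_smallest; exists x, y. Qed.

(** Right multiplication by [y] is a derivation, hence controlled by its values
    on generators, even for [y] outside [B]. *)
Lemma derivation_subalgebra_gen Z B y :
  is_subalgebra B -> Z `<=` B -> (forall z, Z z -> B (bracket z y)) ->
  forall a, subalgebra_gen Z a -> B (bracket a y).
Proof.
move=> [sB mulB] ZB ZyB.
(* The closure argument carries membership in B along: the bracket of
   [a, y] with b only stays in B because b does. *)
pose A := [set a | B a /\ B (bracket a y)].
suff ZA : subalgebra_gen Z `<=` A by move=> a /ZA[].
apply: smallest_sub; last by move=> z Zz; split; [exact: ZB | exact: ZyB].
split; first split.
- by split; rewrite ?bracket0l; exact: sB.1.
- move=> a u v [Bu Buy] [Bv Bvy]; split; first exact: sB.2.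
  by rewrite bracketDl; exact: sB.2.
- move=> u v [Bu Buy] [Bv Bvy]; split; first exact: mulB.
  have -> : bracket (bracket u v) y
            = bracket u (bracket v y) + bracket (bracket u y) v.
    by rewrite leibniz_identity subrK.
  by apply: (subspaceD sB); exact: mulB.
Qed.

End Generated.

(** * Images under morphisms *)

Section Images.
Variables (K : fieldType) (L M : leibnizType K) (g : L -> M).
Hypothesis g_mor : leibniz_morphism g.

Lemma leibniz_morphism0 : g 0 = 0.
Proof.
by have := g_mor.1 (-1) 0 0; rewrite scaler0 addr0 !scaleN1r addNr.
Qed.

Lemma leibniz_morphismB x y : g (x - y) = g x - g y.
Proof. by have := g_mor.1 (-1) y x; rewrite !scaleN1r !(addrC (- _)). Qed.

Lemma image_subspace A : is_subspace A -> is_subspace (g @` A).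
Proof.
move=> [A0 lin]; split; first by exists 0 => //; exact: leibniz_morphism0.
move=> a _ _ [x Ax <-] [y Ay <-].
by exists (a *: x + y); [exact: lin | exact: g_mor.1].
Qed.

Lemma preimage_subspace A : is_subspace A -> is_subspace (g @^-1` A).
Proof.
move=> [A0 lin]; split; first by rewrite /preimage /= leibniz_morphism0.
by move=> a x y Ax Ay; rewrite /preimage /= g_mor.1; exact: lin.
Qed.

Lemma image_subalgebra A : is_subalgebra A -> is_subalgebra (g @` A).
Proof.
move=> [sA mul]; split; first exact: image_subspace.
move=> _ _ [x Ax <-] [y Ay <-].
by exists (bracket x y); [exact: mul | exact: g_mor.2].
Qed.

Lemma preimage_subalgebra A : is_subalgebra A -> is_subalgebra (g @^-1` A).
Proof.
move=> [sA mul]; split; first exact: preimage_subspace.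
by move=> x y Ax Ay; rewrite /preimage /= g_mor.2; exact: mul.
Qed.

Lemma image_subalgebra_gen X :
  g @` subalgebra_gen X = subalgebra_gen (g @` X).
Proof.
apply/seteqP; split.
- rewrite image_sub; apply: smallest_sub.
    exact/preimage_subalgebra/subalgebra_gen_subalgebra.
  by rewrite -image_sub; exact: sub_gen_smallest.
- apply: smallest_sub; first exact/image_subalgebra/subalgebra_gen_subalgebra.
  by apply: image_subset; exact: sub_gen_smallest.
Qed.

Lemma finitely_generated_image A :
  finitely_generated A -> finitely_generated (g @` A).
Proof.
move=> [X finX <-]; exists (g @` X); first exact: finite_image.
by rewrite image_subalgebra_gen.
Qed.

Lemma image_commutator : range g = [set: M] ->
  g @` commutator L = commutator M.
Proof.
move=> g_surj; apply/seteqP; split.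
- rewrite image_sub; apply: smallest_sub.
    exact/preimage_subspace/span_subspace.
  by move=> _ [x [y ->]]; rewrite /preimage /= g_mor.2; exact: commutator_bracket.
- apply: smallest_sub; first exact/image_subspace/span_subspace.
  move=> _ [u [v ->]].
  have [x _ <-] : range g u by rewrite g_surj.
  have [y _ <-] : range g v by rewrite g_surj.
  by exists (bracket x y); [exact: commutator_bracket | rewrite g_mor.2].
Qed.

(** The image of [P] contains generators of [M], so [P] meets every fibre of
    [g]; since [P] contains the kernel, it then contains every fibre. *)
Lemma subalgebra_full (P Y : set L) :
  is_subalgebra P -> (forall x, g x = 0 -> P x) -> Y `<=` P ->
  subalgebra_gen (g @` Y) = [set: M] -> P = [set: L].
Proof.
move=> algP kerP YP genY; apply/seteqP; split=> // x _.
have : (g @` P) (g x).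
  have : subalgebra_gen (g @` Y) (g x) by rewrite genY.
  by apply; split; [exact: image_subalgebra | exact: image_subset].
move=> [p Pp gp]; rewrite -(subrK p x).
apply: (subspaceD algP.1) => //; apply: kerP.
by rewrite leibniz_morphismB gp subrr.
Qed.

End Images.

(** * Lifting finite sets *)

Lemma finite_lift (T : Type) (U : choiceType) (g : T -> U) (A : set T)
    (Y : set U) :
  finite_set Y -> Y `<=` g @` A ->
  exists Z : set T, [/\ finite_set Z, Z `<=` A & g @` Z = Y].
Proof.
move=> /finite_seqP[s ->]; elim: s => [|y s IHs] sA.
  by exists set0; rewrite image_set0 set_nil; split.
have [|Z [finZ ZA gZ]] := IHs.
  by move=> u us; apply: sA; exact: mem_behead.
have [x Ax gx] := sA y (mem_head y s).
exists (x |` Z); split; first by rewrite finite_setU.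
  by move=> u [->|/ZA].
rewrite image_setU image_set1 gx gZ; apply/seteqP; split=> u /=.
  by move=> uys; apply/predU1P.
by rewrite inE => /predU1P.
Qed.

(** * Ascent along a surjection with central kernel *)

Section Ascent.
Variables (K : fieldType) (L M : leibnizType K) (g : L -> M).
Hypothesis g_mor : leibniz_morphism g.
Hypothesis g_surj : range g = [set: M].
Hypothesis ker_central :
  forall x y, g x = 0 -> bracket x y = 0 /\ bracket y x = 0.

(** Brackets with the chosen lifts of generators must be added by hand: lifts
    of generators of [[M, M]] determine [[L, L]] only up to a central part,
    which may be infinite dimensional. *)
Lemma finitely_generated_commutator_lift :
  finitely_generated [set: M] -> finitely_generated (commutator M) ->
  finitely_generated (commutator L).
Proof.
move=> [X finX genX] [W finW genW].
have [|Y [finY _ gY]] := @finite_lift L M g setT X finX.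
  by rewrite g_surj.
have [|Z [finZ ZC gZ]] := @finite_lift L M g (commutator L) W finW.
  by rewrite (image_commutator g_mor g_surj) -genW; exact: sub_gen_smallest.
pose G := Z `|` [set bracket a y | a in Z `|` Y & y in Y].
exists G.
  rewrite finite_setU; split=> //.
  by apply: finite_image2 => //; rewrite finite_setU.
set B := subalgebra_gen G.
have algB : is_subalgebra B by exact: subalgebra_gen_subalgebra.
have GB : G `<=` B by exact: sub_gen_smallest.
have ZB : Z `<=` B by move=> z Zz; apply: GB; left.
have ByB a y : (Z `|` Y) a -> Y y -> B (bracket a y).
  by move=> ZYa Yy; apply: GB; right; exists a => //; exists y.
apply/seteqP; split.
  apply: smallest_sub; first exact: commutator_subalgebra.
  by move=> _ [/ZC //|[a _ [y _ <-]]]; exact: commutator_bracket.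
have gZM : g @` subalgebra_gen Z = commutator M.
  by rewrite image_subalgebra_gen // gZ.
pose D := [set u | forall y, Y y -> B (bracket u y)].
have subD : is_subspace D.
  split=> [y Yy|a u v Du Dv y Yy]; first by rewrite bracket0l; exact: algB.1.1.
  by rewrite bracketDl; apply: algB.1.2; [exact: Du | exact: Dv].
have kerD x : g x = 0 -> D x.
  by move=> gx y _; rewrite (ker_central _ gx).1; exact: algB.1.1.
have ZD : subalgebra_gen Z `<=` D.
  move=> a Za y Yy; apply: (@derivation_subalgebra_gen _ _ Z) => // z Zz.
  by apply: ByB => //; left.
(* D is closed under brackets because it contains every bracket. *)
have commD u v : D (bracket u v).
  have : commutator M (g (bracket u v)).
    by rewrite g_mor.2; exact: commutator_bracket.
  rewrite -gZM => -[a Za ga]; rewrite -(subrK a (bracket u v)).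
  apply: (subspaceD subD); last exact: ZD.
  by apply: kerD; rewrite leibniz_morphismB // ga subrr.
have DT : D = [set: L].
  apply: (@subalgebra_full _ _ _ _ g_mor D Y) => //; last by rewrite gY.
  by move=> u Yu y Yy; apply: ByB => //; right.
(* [D = L] bounds the brackets whose right factor is in [Y]; the Leibniz
   identity extends this to right factors generated by [Y]. *)
pose E := [set v | forall u, B (bracket u v)].
have ET : E = [set: L].
  apply: (@subalgebra_full _ _ _ _ g_mor E Y) => //; last by rewrite gY.
  - split; first split.
    + by move=> u; rewrite bracket0r; exact: algB.1.1.
    + by move=> a v w Ev Ew u; rewrite bracketDr; exact: algB.1.2.
    + move=> v w Ev Ew u; rewrite leibniz_identity.
      exact: (subspaceB algB.1).
  - by move=> x gx u; rewrite (ker_central _ gx).2; exact: algB.1.1.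
  - by move=> y Yy u; have Du : D u; [rewrite DT | exact: Du].
apply: smallest_sub; first exact: algB.1.
by move=> _ [u [v ->]]; have Ev : E v; [rewrite ET | exact: Ev].
Qed.

End Ascent.

(** * The zero algebra *)

Definition zero_leibniz (K : fieldType) : Type := 'rV[K]_0.

Section ZeroAlgebra.
Variable K : fieldType.

HB.instance Definition _ := GRing.Lmodule.on (zero_leibniz K).

Lemma zero_leibniz_all0 (x : zero_leibniz K) : x = 0.
Proof. exact: thinmx0. Qed.

Definition zero_bracket (x y : zero_leibniz K) : zero_leibniz K := 0.

Lemma zero_bracket_linearl y : linear (zero_bracket^~ y).
Proof. by move=> a u v; rewrite [RHS]zero_leibniz_all0. Qed.

Lemma zero_bracket_linearr x : linear (zero_bracket x).
Proof. by move=> a u v; rewrite [RHS]zero_leibniz_all0. Qed.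

Lemma zero_leibniz_identity x y z :
  zero_bracket x (zero_bracket y z) =
    zero_bracket (zero_bracket x y) z - zero_bracket (zero_bracket x z) y.
Proof. by rewrite [RHS]zero_leibniz_all0. Qed.

HB.instance Definition _ := Lmodule_isLeibniz.Build K (zero_leibniz K)
  zero_bracket_linearl zero_bracket_linearr zero_leibniz_identity.

Lemma central_extension_by_zero (m : leibnizType K) :
  central_extension (fun _ : zero_leibniz K => 0 : m) (@idfun m).
Proof.
split.
- split=> [a x y|x y]; first by rewrite scaler0 addr0.
  by rewrite bracket0l.
- by split.
- split; last exact: image_id.
    by move=> x y _; rewrite (zero_leibniz_all0 x) (zero_leibniz_all0 y).
  apply/seteqP; split=> [_ [x _ <-] //|x /= ->]; by exists 0.
- by move=> x y; rewrite bracket0l bracket0r.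
Qed.

End ZeroAlgebra.

(** * The equivalence *)

Theorem theorem2p7 (K : fieldType) (m : leibnizType K)
    (m_fg : finitely_generated [set: m]) :
  [<-> finitely_generated (commutator m);
       exists (r l : leibnizType K) (f : r -> l) (g : l -> m),
         central_extension f g /\ finitely_generated (commutator l);
       forall (r l : leibnizType K) (f : r -> l) (g : l -> m),
         central_extension f g -> finitely_generated (commutator l)].
Proof.
have trivial_ext := central_extension_by_zero m.
tfae.
- by move=> Cm_fg; do 4!eexists; split; first exact: trivial_ext.
- move=> [r0 [l0 [f0 [g0 [[_ g0_mor [_ _ g0_surj] _] Cl0_fg]]]]].
  have Cm_fg : finitely_generated (commutator m).
    rewrite -(image_commutator g0_mor g0_surj).
    exact: finitely_generated_image.
  move=> r l f g [_ g_mor [_ range_f g_surj] f_central].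
  apply: (@finitely_generated_commutator_lift _ _ _ g) => // x y gx.
  have [z _ <-] : range f x by rewrite range_f.
  exact: f_central.
- by move=> ext_fg; exact: ext_fg trivial_ext.
Qed.
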